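(* Suppose $\hat\beta$ is the unique solution of the KKT conditions $$-X^T(Y-X\hat\beta)/n+\lambda\hat z=0,\qquad \|\hat z\|_\infty\le1,\quad \hat z_j={\rm sign}(\hat\beta_j)\ \text{if}\ \hat\beta_j\ne0 .$$ Let $\lambda_\epsilon\ge0$ and $\mathcal T_\epsilon:=\{\|X^T\epsilon\|_\infty/n\le\lambda_\epsilon\}$. Consider some set $S\subset\{1,\dots,p\}$ with ${\rm rank}(X_S)=|S|$ and define $\hat\Gamma_{S^c}:=(X_S^TX_S)^{-1}X_S^TX_{S^c}$ and $\hat C_{S^c}$ by $X\hat C_{S^c}=X_{S^c}-X_S\hat\Gamma_{S^c}$. Suppose $$(\lambda+\lambda_\epsilon)|||\hat\Gamma_{S^c}|||_1+\|\hat C_{S^c}^TX^TX\hat C_{S^c}\beta_{S^c}^0\|_\infty/n\le\lambda-\lambda_\epsilon .$$ Then on $\mathcal T_\epsilon$ we have $\hat\beta_j=0$ for all $j\notin S$.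
   Context: Linear model with fixed design: $Y=X\beta^0+\epsilon$, with $X$ a fixed $n\times p$ real matrix, $\beta^0\in\mathbb R^p$, $\epsilon\in\mathbb R^n$ a noise vector. The KKT conditions, with tuning parameter $\lambda>0$, are those of the Lasso problem $\min_{\beta\in\mathbb R^p}\{\|Y-X\beta\|_2^2/n+2\lambda\|\beta\|_1\}$. $X_S$, $X_{S^c}$ are the submatrices of $X$ of columns in $S$, $S^c$; $\beta^0_{S^c}=\{\beta^0_j\}_{j\in S^c}$. The $p\times|S^c|$ matrix $\hat C_{S^c}$ has the identity in the rows in $S^c$ and $-\hat\Gamma_{S^c}$ in the rows in $S$. For a matrix $A$, $|||A|||_1:=\max_j\sum_k|A_{k,j}|$ (maximal absolute column sum). ''On an event'' means whenever the inequality defining it holds. *)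

(* Defs.v *)
(* On matrices (column vectors included), the library norm
   `|A| is the largest absolute value of an entry, and is 0 for empty
   matrices: on 'cV[R]_p it is the sup-norm. *)
From HB Require Import structures.
From mathcomp Require Import all_boot all_order all_algebra.
From mathcomp Require Import all_classical all_reals all_analysis.

Set Implicit Arguments.
Unset Strict Implicit.
Unset Printing Implicit Defensive.

Import Order.TTheory GRing.Theory Num.Theory.
Import numFieldNormedType.Exports.

Local Open Scope ring_scope.

(* |||A|||_1 *)
Definition max_col_sum (R : realType) (m n : nat) (A : 'M[R]_(m, n)) : R :=
  \big[Num.max/0]_(j < n) \sum_(k < m) `|A k j|.

(* The columns (resp. rows) with index in S, in increasing order. *)
Definition cols_in (R : Type) (m p : nat) (S : {set 'I_p})
    (A : 'M[R]_(m, p)) : 'M[R]_(m, #|S|) :=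
  colsub (fun i : 'I_#|S| => enum_val i) A.

Definition rows_in (R : Type) (m p : nat) (S : {set 'I_p})
    (A : 'M[R]_(p, m)) : 'M[R]_(#|S|, m) :=
  rowsub (fun i : 'I_#|S| => enum_val i) A.

Definition lasso_kkt (R : realType) (n p : nat) (X : 'M[R]_(n, p))
    (Y : 'cV[R]_n) (lambda : R) (beta z : 'cV[R]_p) : Prop :=
  [/\ - (n%:R^-1 *: (X^T *m (Y - X *m beta))) + lambda *: z = 0,
      `|z| <= 1
    & forall j, beta j 0 != 0 -> z j 0 = Num.sg (beta j 0)].

Definition lasso_kkt_solution (R : realType) (n p : nat) (X : 'M[R]_(n, p))
    (Y : 'cV[R]_n) (lambda : R) (beta : 'cV[R]_p) : Prop :=
  exists z : 'cV[R]_p, lasso_kkt X Y lambda beta z.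

Definition Gamma_hat (R : realType) (n p : nat) (X : 'M[R]_(n, p))
    (S : {set 'I_p}) : 'M[R]_(#|S|, #|~: S|) :=
  let XS := cols_in S X in
  invmx (XS^T *m XS) *m XS^T *m cols_in (~: S) X.

(* The column of index k in ~: S is e_k - \sum_(j in S) Gamma_jk e_j; see
   rows_in_C_hat, rows_inC_C_hat and mul_C_hat. *)
Definition C_hat (R : realType) (n p : nat) (X : 'M[R]_(n, p))
    (S : {set 'I_p}) : 'M[R]_(p, #|~: S|) :=
  cols_in (~: S) 1%:M - cols_in S 1%:M *m Gamma_hat X S.

Lemma rows_in_C_hat (R : realType) (n p : nat) (X : 'M[R]_(n, p))
    (S : {set 'I_p}) : rows_in S (C_hat X S) = - Gamma_hat X S.
Proof.
rewrite /C_hat; move: (Gamma_hat X S) => G.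
apply/matrixP => i k; rewrite !mxE.
have iS := enum_valP i; have := enum_valP k; rewrite inE => kS.
have -> : (enum_val i == enum_val k) = false.
  by apply: contraNF kS => /eqP <-.
rewrite add0r; congr (- _).
rewrite (bigD1 i) //= !mxE eqxx mul1r big1 ?addr0 // => j ji.
rewrite !mxE (inj_eq enum_val_inj) eq_sym (negbTE ji); exact: mul0r.
Qed.

Lemma rows_inC_C_hat (R : realType) (n p : nat) (X : 'M[R]_(n, p))
    (S : {set 'I_p}) : rows_in (~: S) (C_hat X S) = 1%:M.
Proof.
apply/matrixP => i k; rewrite !mxE (inj_eq enum_val_inj).
have := enum_valP i; rewrite inE => iS.
rewrite big1 ?subr0 // => j _; rewrite !mxE.
have -> : (enum_val i == enum_val j) = false.
  by apply: contraNF iS => /eqP ->; exact: enum_valP.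
exact: mul0r.
Qed.

Lemma mul_C_hat (R : realType) (n p : nat) (X : 'M[R]_(n, p))
    (S : {set 'I_p}) :
  X *m C_hat X S = cols_in (~: S) X - cols_in S X *m Gamma_hat X S.
Proof.
have XI (T : {set 'I_p}) : X *m cols_in T 1%:M = cols_in T X.
  by rewrite /cols_in mulmx_colsub mulmx1.
by rewrite mulmxBr mulmxA !XI.
Qed.

(* Main.v *)
(* Let b be the part of beta_hat outside S, and C, G the matrices C_hat and
   Gamma_hat. Multiplying the KKT equation by (C b)^T, where X C is orthogonal
   to X_S, the irrepresentability condition gives
     |X C b|^2 + n lambda (|G b|_1 - z_S^T G b) <= 0.
   Both terms are nonnegative, hence vanish: beta_hat - C b has the same fit as
   beta_hat, and z_k (G b)_k = |(G b)_k| for all k in S. So beta_hat - C b, which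
   vanishes outside S and equals beta_hat_S + G b on S, satisfies the KKT
   conditions with the same z, and uniqueness identifies it with beta_hat. *)

Require Import Defs.
From HB Require Import structures.
From mathcomp Require Import all_boot all_order all_algebra.
From mathcomp Require Import all_classical all_reals all_analysis.
From mathcomp Require Import lra.

Set Implicit Arguments.
Unset Strict Implicit.
Unset Printing Implicit Defensive.

Import Order.TTheory GRing.Theory Num.Theory.
Import numFieldNormedType.Exports.

Local Open Scope ring_scope.

Section DotProduct.
Variable R : realDomainType.

Lemma dotmx_ge0 m (v : 'cV[R]_m) : 0 <= (v^T *m v) 0 0.
Proof. by rewrite mxE sumr_ge0 // => i _; rewrite mxE -expr2 sqr_ge0. Qed.

Lemma dotmx_eq0 m (v : 'cV[R]_m) : (v^T *m v) 0 0 = 0 -> v = 0.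
Proof.
rewrite mxE => v0; apply/matrixP => i j; rewrite ord1 mxE; apply/eqP.
have /(_ i isT) : forall i, true -> v^T 0 i * v i 0 = 0.
  by apply: psumr_eq0P => // k _; rewrite mxE -expr2 sqr_ge0.
by rewrite mxE -expr2 => /eqP; rewrite sqrf_eq0.
Qed.

End DotProduct.

(** If [w] is in the left kernel of A^T A, then |A w^T|^2 = w A^T A w^T = 0, so A w^T = 0, and full
    column rank forces w = 0. *)
Lemma gram_unitmx (R : realFieldType) n m (A : 'M[R]_(n, m)) :
  \rank A = m -> A^T *m A \in unitmx.
Proof.
move=> rkA; rewrite -row_free_unit -kermx_eq0; apply/eqP/row_matrixP => i.
set w := row i _.
have /sub_kermxP w0 : (w <= kermx (A^T *m A))%MS by exact: row_sub.
have Aw0 : A *m w^T = 0.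
  by apply: dotmx_eq0; rewrite trmx_mul trmxK mulmxA -(mulmxA w) w0 mul0mx mxE.
have freeA : row_free A^T by rewrite /row_free mxrank_tr rkA.
rewrite row0; apply: (row_free_inj freeA).
by rewrite mul0mx -[LHS]trmxK trmx_mul trmxK Aw0 trmx0.
Qed.

Section SupAndL1Norms.
Variable R : realType.

Definition l1norm m (v : 'cV[R]_m) : R := \sum_i `|v i 0|.

Lemma l1norm_ge0 m (v : 'cV[R]_m) : 0 <= l1norm v.
Proof. exact: sumr_ge0. Qed.

Lemma le_entry_mxnorm m n (A : 'M[R]_(m, n)) i j : `|A i j| <= `|A|.
Proof.
rewrite [leRHS]/Num.norm /= mx_normrE.
exact: (le_bigmax _ (fun ij : 'I_m * 'I_n => `|A ij.1 ij.2|) (i, j)).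
Qed.

(** Hölder's inequality for the sup-norm and the l1 norm. The bound is entrywise so that it applies
    directly to subvectors. *)
Lemma dotmx_le_l1 m (u v : 'cV[R]_m) (c : R) :
  (forall i, `|v i 0| <= c) -> (u^T *m v) 0 0 <= c * l1norm u.
Proof.
move=> vc; rewrite mxE mulr_sumr ler_sum // => i _; rewrite mxE mulrC.
by rewrite (le_trans (ler_norm _)) // normrM ler_wpM2r.
Qed.

(** After the two sums are exchanged, each |v_j| is weighted by the j-th absolute column sum of
    [A]. *)
Lemma l1norm_mulmx_le m n (A : 'M[R]_(m, n)) (v : 'cV[R]_n) :
  l1norm (A *m v) <= max_col_sum A * l1norm v.
Proof.
apply: (@le_trans _ _ (\sum_i \sum_j `|A i j| * `|v j 0|)).
  apply: ler_sum => i _; rewrite mxE (le_trans (ler_norm_sum _ _ _)) //.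
  by apply: ler_sum => j _; rewrite normrM.
rewrite exchange_big mulr_sumr; apply: ler_sum => j _ /=.
rewrite -mulr_suml ler_wpM2r //.
exact: (le_bigmax _ (fun j => \sum_k `|A k j|)).
Qed.

(** The equality case of Hölder: the gaps |u_k| - v_k u_k are nonnegative and their sum is at most
    0, so each one vanishes. *)
Lemma dotmx_eq_l1 m (u v : 'cV[R]_m) : (forall i, `|v i 0| <= 1) ->
  l1norm u <= (u^T *m v) 0 0 -> forall i, v i 0 * u i 0 = `|u i 0|.
Proof.
move=> v1 le_uv i; apply/esym/eqP; rewrite -subr_eq0; apply/eqP.
have d_ge0 k : 0 <= `|u k 0| - v k 0 * u k 0.
  by rewrite subr_ge0 (le_trans (ler_norm _)) // normrM ler_piMl.
apply: (@psumr_eq0P _ _ predT (fun k => `|u k 0| - v k 0 * u k 0)) => //.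
apply/eqP; rewrite eq_le sumr_ge0 ?andbT // sumrB subr_le0.
by rewrite (le_trans le_uv) // mxE ler_sum // => k _; rewrite mxE mulrC.
Qed.

End SupAndL1Norms.

(** Puts the sign condition of KKT in a product form that also covers x = 0 and is convenient for
    sums. *)
Lemma sgr_mul_normP (R : realDomainType) (x z : R) :
  (x != 0 -> z = Num.sg x) <-> z * x = `|x|.
Proof.
split=> [zx|zx x0].
  have [->|/zx ->] := eqVneq x 0; first by rewrite mulr0 normr0.
  by rewrite normrEsg.
by apply: (mulIf x0); rewrite zx normrEsg.
Qed.

Section Columns.
Variables (R : realType) (p : nat).
Implicit Types (S : {set 'I_p}).

Lemma rows_inE m S (A : 'M[R]_(p, m)) :
  rows_in S A = (cols_in S 1%:M)^T *m A.
Proof.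
rewrite [LHS]rowsubE; congr (_ *m _).
by apply/matrixP => i j; rewrite !mxE eq_sym.
Qed.

Lemma cols_rows_in_split (v : 'cV[R]_p) S :
  v = cols_in S 1%:M *m rows_in S v + cols_in (~: S) 1%:M *m rows_in (~: S) v.
Proof.
have part T i : (cols_in T 1%:M *m rows_in T v) i 0 = (v i 0) *+ (i \in T).
  rewrite mxE.
  under eq_bigr do rewrite !mxE.
  rewrite -(big_enum_val (fun k => (i == k)%:R * v k 0)) /=.
  have [iT|iT] := boolP (i \in T).
    rewrite (bigD1 i) //= eqxx mul1r big1 ?addr0 // => k /andP[_ ki].
    by rewrite eq_sym (negbTE ki) mul0r.
  rewrite big1 // => k kT; have [ik|_] := eqVneq i k; last by rewrite mul0r.
  by rewrite ik kT in iT.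
apply/matrixP => i j; rewrite ord1 mxE !part inE.
by case: (i \in S); rewrite ?addr0 ?add0r.
Qed.

Lemma tr_C_hat_mul n (X : 'M[R]_(n, p)) S (z : 'cV[R]_p) :
  (C_hat X S)^T *m z = rows_in (~: S) z - (Gamma_hat X S)^T *m rows_in S z.
Proof.
by rewrite /C_hat linearB /= mulmxBl trmx_mul -mulmxA -!rows_inE.
Qed.

(** Split [v] along S and its complement, then replace X_{S^c} by X C + X_S G. *)
Lemma mulmx_C_hat_split n (X : 'M[R]_(n, p)) S (v : 'cV[R]_p) :
  X *m v = X *m C_hat X S *m rows_in (~: S) v
         + cols_in S X *m (rows_in S v + Gamma_hat X S *m rows_in (~: S) v).
Proof.
have XI T : X *m cols_in T 1%:M = cols_in T X.
  by rewrite /cols_in mulmx_colsub mulmx1.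
rewrite [in LHS](cols_rows_in_split v S) mul_C_hat mulmxDr !(mulmxA X) !XI.
by rewrite mulmxBl mulmxDr mulmxA [X in _ = _ + X]addrC addrA subrK addrC.
Qed.

(** The columns of X C are the residuals of the least squares regression of X_{S^c} on X_S; these
    are the normal equations. *)
Lemma C_hat_orth n (X : 'M[R]_(n, p)) S : \rank (cols_in S X) = #|S| ->
  (X *m C_hat X S)^T *m cols_in S X = 0.
Proof.
move=> rkS; rewrite mul_C_hat linearB /= mulmxBl trmx_mul /Gamma_hat.
have := gram_unitmx rkS; set G := _ *m _ => uG.
have GT : G^T = G by rewrite trmx_mul trmxK.
rewrite -!mulmxA trmx_mul trmx_inv GT trmx_mul trmxK -!mulmxA.
by rewrite -/G mulVmx // mulmx1 subrr.
Qed.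

End Columns.

Theorem theorem2p2 (R : realType) (n p : nat) (n_gt0 : (0 < n)%N)
    (X : 'M[R]_(n, p)) (beta0 : 'cV[R]_p) (eps Y : 'cV[R]_n)
    (model : Y = X *m beta0 + eps)
    (lambda : R) (lambda_gt0 : 0 < lambda)
    (beta_hat : 'cV[R]_p)
    (beta_hat_unique : unique (lasso_kkt_solution X Y lambda) beta_hat)
    (lambda_eps : R) (lambda_eps_ge0 : 0 <= lambda_eps)
    (S : {set 'I_p}) (rank_XS : \rank (cols_in S X) = #|S|)
    (irrep : (lambda + lambda_eps) * max_col_sum (Gamma_hat X S)
      + `|(C_hat X S)^T *m X^T *m X *m C_hat X S *m rows_in (~: S) beta0|
          / n%:R
      <= lambda - lambda_eps) :
  `|X^T *m eps| / n%:R <= lambda_eps ->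
  forall j : 'I_p, j \notin S -> beta_hat j 0 = 0.
Proof.
move=> noise; have [[z [kkt z1 sgz]] uniq_beta] := beta_hat_unique.
have zle1 j : `|z j 0| <= 1 by rewrite (le_trans _ z1) ?le_entry_mxnorm.
set C := C_hat X S in irrep *; set G := Gamma_hat X S in irrep *.
pose b := rows_in (~: S) beta_hat; pose b0 := rows_in (~: S) beta0.
set q := `|_| / _ in irrep; set u := X^T *m eps in noise.
have orth : (X *m C)^T *m cols_in S X = 0 by exact: C_hat_orth.
have nR_gt0 : 0 < n%:R :> R by rewrite ltr0n.
have zE : (n%:R * lambda) *: z = X^T *m (Y - X *m beta_hat).
  move/eqP: kkt; rewrite addrC subr_eq0 => /eqP kkt.
  by rewrite -scalerA kkt scalerA divff ?scale1r ?gt_eqF.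
have zb : (b^T *m rows_in (~: S) z) 0 0 = l1norm b.
  rewrite mxE; apply: eq_bigr => i _; rewrite !mxE mulrC.
  exact/sgr_mul_normP/sgz.
pose D := ((G *m b)^T *m rows_in S z) 0 0.
(* The KKT equation multiplied by (C b)^T. On the left, C^T z = z_{S^c} - G^T z_S; on the right are
   the signal, the noise and the fit of C b. *)
have keyE : n%:R * lambda * (l1norm b - D) =
    (b^T *m (C^T *m X^T *m X *m C *m b0)) 0 0
    + (b^T *m rows_in (~: S) u) 0 0 - ((G *m b)^T *m rows_in S u) 0 0
    - ((X *m C *m b)^T *m (X *m C *m b)) 0 0.
  have tr_b (w : 'cV[R]_p) : b^T *m (C^T *m w) =
      b^T *m rows_in (~: S) w - (G *m b)^T *m rows_in S w.
    by rewrite tr_C_hat_mul mulmxBr (trmx_mul G) -mulmxA.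
  have entryB (A B : 'M[R]_1) : A 0 0 - B 0 0 = (A - B) 0 0 by rewrite !mxE.
  rewrite -zb /D entryB -tr_b -addrA addrA.
  transitivity ((b^T *m (C^T *m ((n%:R * lambda) *: z))) 0 0).
    by rewrite -!scalemxAr [RHS]mxE.
  (* Both fits are split; (X C)^T kills their X_S parts and leaves X C b0 and X C b. *)
  rewrite zE model (mulmx_C_hat_split X S beta0).
  rewrite (mulmx_C_hat_split X S beta_hat).
  rewrite -[X in _ = X + _]addrA entryB -tr_b /u.
  rewrite -/C -/G -/b -/b0.
  have trXC (w : 'cV[R]_n) : C^T *m (X^T *m w) = (X *m C)^T *m w.
    by rewrite trmx_mul mulmxA.
  rewrite -!(mulmxA C^T) -!(mulmxA X^T) !trXC (trmx_mul (X *m C) b).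
  move: (X *m C) orth => M orth.
  rewrite opprD !(mulmxDr M^T) !(mulmxN M^T)
    !(mulmxA M^T (cols_in S X)).
  rewrite orth !mul0mx oppr0 !addr0 -(mulmxA b^T) mulmxDr mulmxDr mulmxN.
  by rewrite [LHS]mxE [X in X + _]mxE [X in _ + X]mxE.
(* Hölder bounds the signal and noise terms of [keyE] by n (q + lambda_eps) |b|_1 + n lambda_eps |G
   b|_1. By [irrep] and |G b|_1 <= |||G|||_1 |b|_1, this is at most n lambda (|b|_1 - |G b|_1). *)
have main : ((X *m C *m b)^T *m (X *m C *m b)) 0 0
    + n%:R * lambda * (l1norm (G *m b) - D) <= 0.
  have noise_u j : `|u j 0| <= n%:R * lambda_eps.
    by rewrite (le_trans (le_entry_mxnorm _ _ _)) // mulrC -ler_pdivrMr.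
  have h1 : (b^T *m (C^T *m X^T *m X *m C *m b0)) 0 0 <= n%:R * q * l1norm b.
    apply: dotmx_le_l1 => i; rewrite (le_trans (le_entry_mxnorm _ _ _)) //.
    by rewrite /q mulrCA divff ?mulr1 ?gt_eqF.
  have h2 : (b^T *m rows_in (~: S) u) 0 0 <= n%:R * lambda_eps * l1norm b.
    by apply: dotmx_le_l1 => i; rewrite mxE.
  have h3 : - ((G *m b)^T *m rows_in S u) 0 0
      <= n%:R * lambda_eps * l1norm (G *m b).
    have -> : - ((G *m b)^T *m rows_in S u) 0 0 =
              ((G *m b)^T *m - rows_in S u) 0 0 by rewrite mulmxN [RHS]mxE.
    by apply: dotmx_le_l1 => i; rewrite 2!mxE normrN.
  have h4 := l1norm_mulmx_le G b; have h5 := l1norm_ge0 b.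
  (* [h6] and [h7] multiply [h4] and [irrep] by nonnegative factors, so that only linear reasoning
     on the products remains. *)
  have h6 : n%:R * (lambda + lambda_eps) * l1norm (G *m b)
      <= n%:R * (lambda + lambda_eps) * (max_col_sum G * l1norm b).
    by rewrite ler_wpM2l // mulr_ge0 ?addr_ge0 // ltW.
  have h7 : n%:R * l1norm b * ((lambda + lambda_eps) * max_col_sum G + q)
      <= n%:R * l1norm b * (lambda - lambda_eps).
    by rewrite ler_wpM2l // mulr_ge0 // ltW.
  lra.
have zSle1 i : `|rows_in S z i 0| <= 1 by rewrite mxE.
have D_le : D <= l1norm (G *m b) by rewrite -[leRHS]mul1r; exact: dotmx_le_l1.
have nl_gt0 : 0 < n%:R * lambda by rewrite mulr_gt0.
have XCb0 : X *m C *m b = 0.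
  apply: dotmx_eq0; apply/eqP; rewrite eq_le dotmx_ge0 andbT.
  rewrite (le_trans _ main) // lerDl mulr_ge0 ?subr_ge0 //; exact: ltW.
have zG : forall i, rows_in S z i 0 * (G *m b) i 0 = `|(G *m b) i 0|.
  apply: dotmx_eq_l1 => //; rewrite -/D -subr_le0 -(pmulr_rle0 _ nl_gt0).
  by rewrite (le_trans _ main) // lerDr dotmx_ge0.
pose beta' := beta_hat - C *m b.
have beta'C : rows_in (~: S) beta' = 0.
  rewrite /beta' [LHS]rows_inE mulmxBr mulmxA -!rows_inE rows_inC_C_hat mul1mx.
  by rewrite subrr.
have beta'S : rows_in S beta' = rows_in S beta_hat + G *m b.
  rewrite /beta' [LHS]rows_inE mulmxBr mulmxA -!rows_inE rows_in_C_hat mulNmx.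
  by rewrite opprK.
have beta'_out j : j \notin S -> beta' j 0 = 0.
  rewrite -finset.in_setC => jS.
  have /(congr1 (fun A : 'cV[R]__ => A (enum_rank_in jS j) 0)) := beta'C.
  by rewrite !mxE enum_rankK_in.
suff kkt' : lasso_kkt_solution X Y lambda beta'.
  by move=> j jS; rewrite (uniq_beta _ kkt') beta'_out.
(* The stationarity equation involves only the fit, which is unchanged since X C b = 0. *)
exists z; split=> // [|j].
  by rewrite /beta' (mulmxBr X) (mulmxA X) XCb0 subr0.
apply/sgr_mul_normP; have [jS|jS] := boolP (j \in S); last first.
  by rewrite beta'_out // mulr0 normr0.
have -> : beta' j 0 = beta_hat j 0 + (G *m b) (enum_rank_in jS j) 0.
  have /(congr1 (fun A : 'cV[R]__ => A (enum_rank_in jS j) 0)) := beta'S.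
  by rewrite [LHS]mxE [RHS]mxE [X in X + _]mxE enum_rankK_in.
have zj : z j 0 * beta_hat j 0 = `|beta_hat j 0| by apply/sgr_mul_normP/sgz.
have := zG (enum_rank_in jS j); rewrite [X in X * _]mxE enum_rankK_in // => zGj.
set g := (G *m b) _ _ in zGj *.
(* With x = [beta_hat j 0], z_j (x + g) = |x| + |g| >= |x + g| by the triangle inequality; the
   converse bound is |z_j| <= 1. *)
apply/eqP; rewrite eq_le mulrDr zj zGj ler_normD andbT -zj -zGj -mulrDr.
by rewrite (le_trans (ler_norm _)) // normrM ler_piMl.
Qed.
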